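(* Let $n$ be an arbitrary positive integer and set $$X=X(n)=\lfloor\log n\rfloor,\qquad N=N(n)=\Bigl(n\prod_{p\le X}p\Bigr)^X,$$ where the product is over primes $p\le X$. Then $n\mid N$ and $$ D(N)\le \frac{\varphi(N)}{N}\bigl(1+L_P^{opt}(N)\bigr). $$
   Context: For a positive integer $m$, a set $S\subseteq \mathbb{Z}/m\mathbb{Z}$ is product-free if there are no $a,b,c\in S$ with $ab\equiv c\pmod m$; $D(m)$ is the maximum of $|S|/m$ over all product-free $S\subseteq\mathbb{Z}/m\mathbb{Z}$. $\varphi$ is Euler's totient function. For a positive integer $m$, the linear program $(P_m)$ has one real variable $\alpha_u$ for each divisor $u>1$ of $m$ and asks to maximize $\sum_{u\mid m,\,u>1}\alpha_u/u$ subject to $0\le\alpha_u\le1$ for all such $u$ and $\alpha_u+\alpha_v+\alpha_{uv}\le2$ for every unordered pair $\{u,v\}$ of divisors of $m$ with $u,v>1$ and $uv\mid m$ (with $u=v$ allowed when $u^2\mid m$). $L_P^{opt}(m)$ denotes its optimal value (equal to $0$ when $m=1$, where there are no variables). $\log$ is the natural logarithm; an empty product equals $1$.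
   Formalization: The divisibility n | N is claimed only for n ≠ 2, since for n = 2 one has X = ⌊log 2⌋ = 0 and N = 1, which 2 does not divide; the bound on D(N) is proved for every positive n. *)

(* Defs.v *)
From mathcomp Require Import all_boot all_order all_algebra.
From mathcomp Require Import all_classical all_reals all_analysis.

Set Implicit Arguments.
Unset Strict Implicit.
Unset Printing Implicit Defensive.

Import Order.TTheory GRing.Theory Num.Theory.

Local Open Scope classical_set_scope.
Local Open Scope ring_scope.

(* Z/mZ is represented by its least residues 'I_m, not by 'Z_m, since the case *)
(* m = 1 matters and 'Z_1 is Z/2Z.                                             *)
Definition product_free (m : nat) (S : {set 'I_m}) : Prop :=
  ~ exists a b c : 'I_m,
      [/\ a \in S, b \in S, c \in S & (a * b = c %[mod m])%N].

Definition max_density (R : realType) (m : nat) : R :=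
  (\max_(S : {set 'I_m} | `[< product_free S >]) #|S|)%N%:R / m%:R.

(* Only the values of alpha at the divisors u > 1 of m are LP variables; the  *)
(* other values are neither constrained nor used in the objective.            *)
Definition LP_feasible (R : realType) (m : nat) (alpha : nat -> R) : Prop :=
  (forall u : nat, (1 < u)%N -> (u %| m)%N -> 0 <= alpha u <= 1) /\
  (forall u v : nat, (1 < u)%N -> (1 < v)%N -> (u * v %| m)%N ->
     alpha u + alpha v + alpha (u * v)%N <= 2).

Definition LP_objective (R : realType) (m : nat) (alpha : nat -> R) : R :=
  \sum_(u <- divisors m | (1 < u)%N) alpha u / u%:R.

(* For m > 0 this set of values is nonempty (alpha = 0) and bounded above, so *)
(* sup does not take its default value.                                       *)
Definition LP_opt (R : realType) (m : nat) : R :=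
  sup [set LP_objective m alpha | alpha in [set a : nat -> R | LP_feasible m a]].

(* truncn is the floor on nonnegative reals, and ln n%:R >= 0 for n > 0. *)
Definition X_of (R : realType) (n : nat) : nat := Num.truncn (ln (n%:R : R)).

Definition N_of (R : realType) (n : nat) : nat :=
  ((n * \prod_(p < (X_of R n).+1 | prime p) p) ^ X_of R n)%N.

(* Main.v *)
(** Let [S] be product-free modulo [m].  For [u %| m] the residues of gcd [u]
    with [m] form one orbit of the unit group, of size [totient (m %/ u)]; let
    [alpha u] be the density of [S] in it.  If [alpha u > 0], multiplication by
    an element of [S] of gcd [u] sends [S] in class [v] into the complement of
    [S] in class [u * v] and does not lower its density, so [alpha] is feasible.

    Since [totient (m %/ u)] exceeds [totient m / u] exactly when [u] contains
    the full power of some prime [p] of [m], [#|S|] exceeds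
    [totient m * \sum_u alpha u / u] by at most an excess that must be paid for
    by [alpha 1 <= 1/2].  If every prime of [m] has exponent at least [X], the
    excess is at most [m * \sum_p p ^- X.+1], while [totient m / m] is at least
    [1 / (w + 1)] where [w] is the number of primes of [m].  As
    [n < 3 ^ X.+1], this suffices for [X >= 3]; the finitely many [n] with
    [X <= 2] are checked by computation, using in addition that [alpha u <= 1/2]
    whenever [u] and [m %/ u] are coprime. *)

Require Import Defs.
From mathcomp Require Import all_boot all_order all_algebra.
From mathcomp Require Import all_classical all_reals all_analysis.
From mathcomp Require Import cyclic ring lra zify.
From Stdlib Require BinNat.

Set Implicit Arguments.
Unset Strict Implicit.
Unset Printing Implicit Defensive.

Import Order.TTheory GRing.Theory Num.Theory.

(** * Unit orbits modulo m *)

Local Open Scope nat_scope.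

(** Add to [y] the multiple [d * t], where [t] is the part of [m] prime to [y]: each prime of [m]
    divides exactly one of [y] and [d * t]. *)
Lemma coprime_lift m d y : 0 < m -> d %| m -> coprime y d ->
  exists2 h, coprime h m & h = y %[mod d].
Proof.
move=> m_gt0 d_dvd co_yd; have d_gt0 := dvdn_gt0 m_gt0 d_dvd.
(* At [y = 0] the set of primes of [y] is empty as a convention, and the choice of [t] below would
   fail. *)
wlog y_gt0 : y co_yd / 0 < y.
  move=> /(_ (y + d)) []; rewrite ?ltn_addl //.
    by rewrite -coprime_modl modnDr coprime_modl.
  by move=> h co_hm h_y; exists h; rewrite // h_y modnDr.
pose t := m`_(\pi(y)^').
exists (y + d * t); last by rewrite addnC mulnC modnMDl.
apply/negPn/negP => nco.
have g_gt1 : 1 < gcdn (y + d * t) m.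
  by rewrite ltn_neqAle eq_sym nco gcdn_gt0 m_gt0 orbT.
have p_pr := pdiv_prime g_gt1; set p := pdiv _ in p_pr.
have /andP[p_h p_m] : (p %| y + d * t) && (p %| m) by rewrite -dvdn_gcd pdiv_dvd.
have [p_y|p_ny] := boolP (p %| y).
  move: p_h; rewrite dvdn_addr // Euclid_dvdM // => /orP[p_d|p_t].
    have := dvdn_gcd p y d; rewrite (eqP co_yd) p_y p_d dvdn1 => /eqP p1.
    by rewrite p1 in p_pr.
  have /pnatP-/(_ (part_gt0 _ _) p p_pr p_t) := part_pnat \pi(y)^' m.
  by rewrite inE /= mem_primes p_pr y_gt0 p_y.
have p_t : p %| t.
  suff: p \in primes t by rewrite mem_primes => /and3P[].
  rewrite primes_part mem_filter inE /= mem_primes p_pr y_gt0 (negPf p_ny) /=.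
  by rewrite mem_primes p_pr m_gt0.
by move: p_h; rewrite dvdn_addl ?dvdn_mull // (negPf p_ny).
Qed.

Lemma unit_transitive m u x y : 0 < m -> gcdn x m = u -> gcdn y m = u ->
  exists2 h, coprime h m & x * h = y %[mod m].
Proof.
move=> m_gt0 xu yu; have u_gt0 : 0 < u by rewrite -xu gcdn_gt0 m_gt0 orbT.
have u_m : u %| m by rewrite -xu dvdn_gcdr.
have /dvdnP[x' x_def] : u %| x by rewrite -xu dvdn_gcdl.
have /dvdnP[y' y_def] : u %| y by rewrite -yu dvdn_gcdl.
have /dvdnP[d m_def] := u_m.
have co z' : gcdn (z' * u) m = u -> coprime z' d.
  by rewrite m_def -muln_gcdl -[in RHS](mul1n u) => /eqP; rewrite eqn_pmul2r.
have co_x' : coprime x' d by apply: co; rewrite -x_def.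
have co_y' : coprime y' d by apply: co; rewrite -y_def.
have d_gt0 : 0 < d by move: m_gt0; rewrite m_def muln_gt0 => /andP[].
(* By Euler's theorem this power of [x'] is its inverse modulo [d], so [h] lifts the quotient of
   [y'] by [x']. *)
have [||h co_hm h_eq] := @coprime_lift m d (y' * x' ^ (totient d).-1) m_gt0.
- by rewrite m_def dvdn_mulr.
- by rewrite coprimeMl co_y' coprimeXl.
exists h => //.
rewrite x_def y_def m_def mulnAC -!muln_modl; congr (_ * _).
rewrite -modnMmr h_eq modnMmr mulnCA -expnS prednK ?totient_gt0 //.
by rewrite -modnMmr Euler_exp_totient // modnMmr muln1.
Qed.

Section ProductFree.
Variable M : nat.
Let m := M.+1.

Definition zunits : {set 'I_m} := [set g : 'I_m | coprime g m].
Definition gcd_class (u : nat) : {set 'I_m} := [set x : 'I_m | gcdn x m == u].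
(** Pulling back to the units puts all classes inside one set of size [totient m], where different
    [u] can be compared. *)
Definition unit_shift (S : {set 'I_m}) (u : nat) : {set 'I_m} :=
  [set g in zunits | inZp (u * g) \in S].

Lemma card_coprime n : #|[set x : 'I_n | coprime x n]| = totient n.
Proof.
rewrite totient_count_coprime big_mkord -sum1dep_card big_mkcond /=.
by apply: eq_bigr => i _; rewrite coprime_sym; case: coprime.
Qed.

Lemma card_zunits : #|zunits| = totient m.
Proof. exact: card_coprime. Qed.

Lemma card_gcd_class u : u %| m -> #|gcd_class u| = totient (m %/ u).
Proof.
move=> u_m; have u_gt0 : 0 < u := dvdn_gt0 (ltn0Sn M) u_m.
have m_def := divnK u_m; set d := m %/ u in m_def *.
have lt_um (y : 'I_d) : u * y < m by rewrite -m_def mulnC ltn_pmul2r.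
rewrite -card_coprime -(card_in_imset (f := fun y : 'I_d => Ordinal (lt_um y))).
  apply: eq_card => x; rewrite inE; apply/eqP/imsetP => [xu | [y]].
    have /dvdnP[y x_def] : u %| x by rewrite -xu dvdn_gcdl.
    have lt_y : y < d by rewrite -(ltn_pmul2r u_gt0) -x_def m_def.
    exists (Ordinal lt_y); last by apply: val_inj; rewrite /= mulnC.
    move: xu; rewrite inE /= x_def -m_def -muln_gcdl -[in RHS](mul1n u).
    by move/eqP; rewrite eqn_pmul2r.
  rewrite inE => co_y ->; rewrite /= -m_def mulnC -muln_gcdl.
  by rewrite (eqP co_y) mul1n.
move=> y z _ _ [] /eqP; rewrite eqn_pmul2l // => /eqP; exact: val_inj.
Qed.

Lemma inZp_mul_inj g (x y : 'I_m) : coprime g m ->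
  inZp (g * x) = inZp (g * y) :> 'I_m -> x = y.
Proof.
move=> co_g /(congr1 val) /= /eqP.
wlog le_yx : x y / y <= x.
  move=> W; case: (leqP y x) => [/W//|/ltnW /W{}W].
  by rewrite eq_sym => /W.
rewrite eqn_mod_dvd ?leq_mul // -mulnBr Gauss_dvdr 1?coprime_sym //.
by rewrite -eqn_mod_dvd // !modn_small // => /eqP /val_inj.
Qed.

Lemma gcdn_mul_unit u g : u %| m -> coprime g m -> gcdn (u * g) m = u.
Proof.
move=> u_m co_g; rewrite gcdnC Gauss_gcdl 1?coprime_sym //.
by apply/gcdn_idPr.
Qed.

Lemma card_unit_shift_sum (S : {set 'I_m}) u : u %| m ->
  #|unit_shift S u| =
  \sum_(x in S :&: gcd_class u) #|[set g in zunits | inZp (u * g) == x]|.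
Proof.
move=> u_m; rewrite -sum1_card.
rewrite (partition_big (fun g : 'I_m => inZp (u * g) : 'I_m)
  (mem (S :&: gcd_class u))) /=; last first.
  move=> g; rewrite !inE => /andP[co_g ->] /=.
  by rewrite gcdn_modl gcdn_mul_unit.
apply: eq_bigr => x; rewrite !inE => /andP[xS _].
rewrite sum1dep_card; apply: eq_card => g; rewrite !inE.
by case: eqP => [->|]; rewrite ?xS ?andbT ?andbF.
Qed.

(** A unit [h] carrying [x] to [y] maps the first fibre injectively into the second; by symmetry all
    fibres have the same size. *)
Lemma card_fiber_leq u (x y : 'I_m) : x \in gcd_class u -> y \in gcd_class u ->
  #|[set g in zunits | inZp (u * g) == x]| <=
  #|[set g in zunits | inZp (u * g) == y]|.
Proof.
rewrite !inE => /eqP xu /eqP yu.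
have [h co_h hxy] := @unit_transitive m u x y (ltn0Sn M) xu yu.
rewrite -(card_in_imset (f := fun g : 'I_m => inZp (h * g) : 'I_m)); last first.
  by move=> g g' _ _; apply: inZp_mul_inj.
apply/subset_leq_card/fintype.subsetP => _ /imsetP[g + ->].
rewrite !inE => /andP[co_g /eqP/(congr1 val)/= gx].
rewrite coprime_modl coprimeMl co_h co_g /=.
apply/eqP/val_inj; rewrite /= modnMmr mulnCA -modnMmr gx mulnC.
by rewrite hxy modn_small.
Qed.

(** All fibres have a common size [k]; comparing [S] with the full set of residues eliminates
    [k]. *)
Lemma card_unit_shift (S : {set 'I_m}) u : u %| m ->
  #|S :&: gcd_class u| * totient m = #|unit_shift S u| * totient (m %/ u).
Proof.
move=> u_m.
have lt_u : inZp u \in gcd_class u by rewrite inE gcdn_modl; apply/eqP/gcdn_idPl.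
pose k := #|[set g in zunits | inZp (u * g) == inZp u :> 'I_m]|.
have shiftE (T : {set 'I_m}) : #|unit_shift T u| = #|T :&: gcd_class u| * k.
  rewrite card_unit_shift_sum // -sum_nat_const; apply: eq_bigr => x.
  rewrite inE => /andP[_ xu]; apply/eqP.
  by rewrite eqn_leq !(card_fiber_leq (u := u)).
rewrite shiftE -card_gcd_class // -mulnA (mulnC k); congr (_ * _).
rewrite -[gcd_class u]finset.setTI -shiftE -card_zunits.
by apply: eq_card => g; rewrite !inE andbT.
Qed.

(** * Product-free sets inside the gcd classes *)

Variable S : {set 'I_m}.
Hypothesis S_free : forall a b, a \in S -> b \in S -> inZp (a * b) \notin S.

(** If [u * g] is in [S], translation by [g] moves [unit_shift S v] off [unit_shift S (u * v)],
    since [(u * g) * (v * h)] is a product of two elements of [S]. *)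
Lemma unit_shift_product u v : 0 < #|unit_shift S u| ->
  #|unit_shift S v| + #|unit_shift S (u * v)| <= totient m.
Proof.
case/card_gt0P => g; rewrite !inE => /andP[co_g gS].
rewrite -(card_in_imset (f := fun h : 'I_m => inZp (g * h) : 'I_m)
  (D := unit_shift S v)); last by move=> h h' _ _; apply: inZp_mul_inj.
rewrite -card_zunits -[X in _ <= X](cardsID (unit_shift S (u * v))) addnC leq_add //.
  by apply/subset_leq_card/fintype.subsetP => h; rewrite !inE => /andP[-> ->].
apply/subset_leq_card/fintype.subsetP => _ /imsetP[h + ->].
rewrite !inE => /andP[co_h hS].
rewrite coprime_modl coprimeMl co_g co_h /= andbT.
suff -> : inZp (u * v * ((g * h) %% m)) =
  inZp ((inZp (u * g) : 'I_m) * (inZp (v * h) : 'I_m)) :> 'I_m by exact: S_free.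
by apply: val_inj; rewrite /= modnMm modnMmr mulnACA.
Qed.

(* For a unitary divisor [u], [gcd_class u] is a group under multiplication. *)
Lemma card_unitary_class u : u %| m -> coprime u (m %/ u) ->
  2 * #|S :&: gcd_class u| <= totient (m %/ u).
Proof.
move=> u_m co_u; set T := S :&: _.
have m_def := divnK u_m; set d := m %/ u in co_u m_def *.
have [T0|[a]] := set_0Vmem T; first by rewrite T0 cards0.
rewrite inE => /andP[aS]; rewrite inE => /eqP au.
have [a' a_def] : exists a', nat_of_ord a = a' * u.
  by apply/dvdnP; rewrite -au dvdn_gcdl.
have u_gt0 : 0 < u := dvdn_gt0 (ltn0Sn M) u_m.
have co_ad : coprime a d.
  rewrite a_def coprimeMl co_u andbT.
  by move/eqP: au; rewrite a_def -m_def -muln_gcdl -[in X in _ == X](mul1n u) eqn_pmul2r.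
rewrite mul2n -addnn -{1}(card_in_imset (f := fun b : 'I_m => inZp (a * b) : 'I_m)
  (D := T)); last first.
  move=> b c; rewrite !inE => /andP[_ /eqP bu] /andP[_ /eqP cu] /(congr1 val)/= /eqP.
  wlog le_cb : b c bu cu / c <= b.
    move=> W; case: (leqP c b) => [/W|/ltnW /W{}W]; first exact.
    by rewrite eq_sym => /W ->.
  rewrite eqn_mod_dvd ?leq_mul // -mulnBr => m_abc.
  suff: m %| b - c by rewrite -eqn_mod_dvd // !modn_small // => /eqP /val_inj.
  (* [a] is invertible only modulo [d]; modulo [u] both residues vanish, and [u] and [d] are
     coprime. *)
  have u_b : u %| b by rewrite -bu dvdn_gcdl.
  have u_c : u %| c by rewrite -cu dvdn_gcdl.
  rewrite -[X in X %| _]m_def Gauss_dvd 1?coprime_sym // (dvdn_sub u_b u_c) andbT.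
  rewrite -(@Gauss_dvdr _ a) 1?coprime_sym //.
  by apply: dvdn_trans m_abc; rewrite -[X in _ %| X]m_def dvdn_mulr.
rewrite -card_gcd_class // -[X in _ <= X](cardsID S) addnC leq_add //.
  by rewrite finset.setIC.
apply/subset_leq_card/fintype.subsetP => _ /imsetP[b + ->].
rewrite !inE => /andP[bS /eqP bu]; rewrite S_free //= gcdn_modl.
have [b' b_def] : exists b', nat_of_ord b = b' * u.
  by apply/dvdnP; rewrite -bu dvdn_gcdl.
have co_bd : coprime b d.
  rewrite b_def coprimeMl co_u andbT.
  by move/eqP: bu; rewrite b_def -m_def -muln_gcdl -[in X in _ == X](mul1n u) eqn_pmul2r.
rewrite -[X in gcdn _ X]m_def Gauss_gcdr ?coprimeMl ?co_ad ?co_bd //.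
by apply/eqP/gcdn_idPr; rewrite a_def -mulnA dvdn_mull ?dvdn_mulr.
Qed.

End ProductFree.

Local Open Scope ring_scope.

(** * Size of the excess *)

Lemma card_gcd_classes M (S : {set 'I_M.+1}) :
  #|S| = (\sum_(u <- divisors M.+1) #|S :&: gcd_class M u|)%N.
Proof.
under eq_bigr => u _ do rewrite -sum1_card big_mkcond /=.
rewrite exchange_big /= -sum1_card big_mkcond /=; apply: eq_bigr => x _.
rewrite -big_mkcond /= sum1_count.
have -> : count (fun u => x \in S :&: gcd_class M u) (divisors M.+1) =
    count (predI (fun _ => x \in S) (pred1 (gcdn x M.+1))) (divisors M.+1).
  by apply: eq_count => u; rewrite !inE eq_sym.
case: (x \in S); last by rewrite (@eq_count _ _ pred0) ?count_pred0.
rewrite (@eq_count _ _ (pred1 (gcdn x M.+1))) // count_uniq_mem ?divisors_uniq //.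
by rewrite -dvdn_divisors // dvdn_gcdr.
Qed.

Lemma sum_totient_quotient M (P : pred nat) :
  (\sum_(u <- divisors M.+1 | P u) totient (M.+1 %/ u))%N =
  #|[set x : 'I_M.+1 | P (gcdn x M.+1)]|.
Proof.
rewrite card_gcd_classes big_mkcond /=; apply: eq_big_seq => u.
rewrite -dvdn_divisors // => u_m; have [Pu|nPu] := ifPn.
  rewrite -card_gcd_class //; apply: eq_card => x; rewrite !inE.
  by case: eqP => [->|]; rewrite ?Pu ?andbF.
apply/esym/eqP; rewrite cards_eq0; apply/eqP/finset.setP => x; rewrite !inE.
by case: eqP => [->|]; rewrite ?(negPf nPu) ?andbF.
Qed.

Lemma card_multiples m q : (0 < q)%N -> (q %| m)%N ->
  (#|[set x : 'I_m | (q %| x)%N]| <= m %/ q)%N.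
Proof.
move=> q_gt0 q_m; have lt_div (x : 'I_m) : (x %/ q < m %/ q)%N.
  by rewrite ltn_divLR // divnK.
rewrite -[X in (_ <= X)%N]card_ord.
apply: (@leq_card_in _ _ (fun x => Ordinal (lt_div x))) => // x y.
rewrite !inE => q_x q_y [] e; apply: val_inj.
by rewrite /= -(divnK q_x) e divnK.
Qed.

(* If [p] does not divide [m %/ u] then [u] carries the full power of [p]. *)
Lemma sum_totient_full_power m p X : (0 < m)%N -> prime p -> (p ^ X %| m)%N ->
  (\sum_(u <- divisors m | ~~ (p %| m %/ u)) totient (m %/ u) <= m %/ p ^ X)%N.
Proof.
case: m => // M _ p_pr pX_m.
have pX_gt0 : (0 < p ^ X)%N by rewrite expn_gt0 prime_gt0.
rewrite (sum_totient_quotient _ (fun u => ~~ (p %| M.+1 %/ u)%N)).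
apply: leq_trans (card_multiples pX_gt0 pX_m).
apply/subset_leq_card/fintype.subsetP => x; rewrite !inE => np.
apply: dvdn_trans (dvdn_gcdl x M.+1).
(* The modulus is this quotient times the gcd, and [p] is prime to the quotient, so [p ^ X] divides
   the gcd. *)
rewrite -(@Gauss_dvdr _ (M.+1 %/ gcdn x M.+1)); last first.
  by rewrite coprimeXl // prime_coprime.
by rewrite divnK ?dvdn_gcdr.
Qed.

(** * Euler products and sums over primes *)

Section RealEstimates.
Variable R : realFieldType.

Lemma totient_prodr m d : (0 < m)%N -> (d %| m)%N ->
  (totient d)%:R = d%:R * \prod_(p <- primes m | (p %| d)%N) (1 - p%:R^-1) :> R.
Proof.
move=> m_gt0 d_m; have d_gt0 := dvdn_gt0 m_gt0 d_m.
rewrite -big_filter (perm_big (primes d)) /=; last first.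
  apply: uniq_perm; rewrite ?filter_uniq ?primes_uniq // => p.
  rewrite mem_filter !mem_primes m_gt0 d_gt0 /= andbCA.
  case: (prime p) => //=; case: (boolP (p %| d)%N) => //= p_d.
  exact: dvdn_trans p_d d_m.
rewrite totientE // [in d%:R](prod_prime_decomp d_gt0) prime_decompE big_map /=.
rewrite !natr_prod -big_split /=; apply: eq_big_seq => p.
rewrite mem_primes => /and3P[p_pr _ p_d].
have p_neq0 : p%:R != 0 :> R by rewrite pnatr_eq0 -lt0n prime_gt0.
have /prednK <- : (0 < logn p d)%N by rewrite logn_gt0 mem_primes p_pr d_gt0.
rewrite /= natrM expnS natrM -subn1 natrB ?prime_gt0 //.
by field.
Qed.

(** The Weierstrass product inequality. *)
Lemma prod_subr_ge (I : eqType) (s : seq I) (P : pred I) (x : I -> R) :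
  (forall i, i \in s -> 0 <= x i <= 1) ->
  1 - \sum_(i <- s | P i) x i <= \prod_(i <- s | P i) (1 - x i) <= 1.
Proof.
elim: s => [|i s IHs] x01; first by rewrite !big_nil subr0 lexx.
have {IHs} /andP[lb ub] : 1 - \sum_(i <- s | P i) x i <=
    \prod_(i <- s | P i) (1 - x i) <= 1.
  by apply: IHs => j js; apply: x01; rewrite inE js orbT.
have pge0 : 0 <= \prod_(i <- s | P i) (1 - x i).
  rewrite big_seq_cond prodr_ge0 // => j /andP[js _].
  by have := x01 j; rewrite inE js orbT subr_ge0 => /(_ isT)/andP[].
have /x01/andP[xi0 xi1] := mem_head i s.
rewrite !big_cons; case: ifP => _; last by rewrite lb.
by apply/andP; split; nra.
Qed.

(** The Euler products of [m] and [m %/ u] differ by the factors of the primes lost in [m %/ u]; the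
    Weierstrass inequality bounds their effect. *)
Lemma totient_deficit m u : (0 < m)%N -> (u %| m)%N ->
  0 <= ((totient (m %/ u))%:R - (totient m)%:R / u%:R : R) <=
  (totient (m %/ u))%:R * \sum_(p <- primes m | ~~ (p %| m %/ u)%N) p%:R^-1.
Proof.
move=> m_gt0 u_m; have u_gt0 := dvdn_gt0 m_gt0 u_m.
have u_neq0 : u%:R != 0 :> R by rewrite pnatr_eq0 -lt0n.
have d_m : (m %/ u %| m)%N by rewrite dvdn_div.
have -> : (totient m)%:R / u%:R = (totient (m %/ u))%:R *
    \prod_(p <- primes m | ~~ (p %| m %/ u)%N) (1 - p%:R^-1) :> R.
  rewrite (totient_prodr m_gt0 (dvdnn m)) (totient_prodr m_gt0 d_m).
  have -> : \prod_(p <- primes m | (p %| m)%N) (1 - p%:R^-1) =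
      \prod_(p <- primes m) (1 - p%:R^-1) :> R.
    rewrite big_seq_cond [RHS]big_seq; apply: eq_bigl => p.
    by rewrite mem_primes; case: (p %| m)%N; rewrite ?andbT ?andbF.
  by rewrite [in LHS](bigID (fun p => p %| m %/ u)%N) /= natf_div //; field.
have x01 p : p \in primes m -> 0 <= (p%:R^-1 : R) <= 1.
  rewrite mem_primes => /andP[/prime_gt0 p_gt0 _].
  by rewrite invr_ge0 ler0n invf_le1 ?ltr0n ?ler1n.
have /andP[] := prod_subr_ge (fun p => ~~ (p %| m %/ u)%N) x01.
set P := \prod_(_ <- _ | _) _; set Q := \sum_(_ <- _ | _) _.
have : 0 <= (totient (m %/ u))%:R :> R by [].
set t := _%:R => t0 PQ P1.
by apply/andP; split; nra.
Qed.

(** After exchanging the sums, each prime [p] contributes at most [m / p ^ X] residues, weighted by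
    [1 / p]. *)
Lemma sum_deficit_le m X : (0 < m)%N ->
  (forall p, p \in primes m -> (p ^ X %| m)%N) ->
  \sum_(u <- divisors m) ((totient (m %/ u))%:R - (totient m)%:R / u%:R) <=
  m%:R * \sum_(p <- primes m) p%:R ^- X.+1 :> R.
Proof.
move=> m_gt0 pX_m.
apply: (@le_trans _ _ (\sum_(u <- divisors m) \sum_(p <- primes m |
    ~~ (p %| m %/ u)%N) (totient (m %/ u))%:R * p%:R^-1)).
  rewrite big_seq [leRHS]big_seq; apply: ler_sum => u.
  rewrite -dvdn_divisors // => u_m; rewrite -mulr_sumr.
  by have /andP[] := totient_deficit m_gt0 u_m.
rewrite (exchange_big_dep predT) //= mulr_sumr.
rewrite big_seq [leRHS]big_seq; apply: ler_sum => p p_m.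
have p_pr : prime p by move: p_m; rewrite mem_primes => /andP[].
rewrite -mulr_suml -natr_sum exprS invfM mulrA mulrAC.
rewrite ler_wpM2r ?invr_ge0 ?ler0n // -natrX -natf_div ?pX_m //.
by rewrite ler_nat sum_totient_full_power ?pX_m.
Qed.

(** The [i]-th term of [s] is at least [a + i], and the product of the [1 - 1 / (a + i)]
    telescopes. *)
Lemma prod_path_ge a (s : seq nat) : (0 < a)%N -> path ltn a s ->
  a%:R / (a + size s)%:R <= \prod_(p <- s) (1 - p%:R^-1) :> R.
Proof.
elim: s a => [|x s IHs] a a_gt0 /=.
  by rewrite big_nil addn0 divff // pnatr_eq0 -lt0n.
move=> /andP[lt_ax /(IHs _ (ltn_trans a_gt0 lt_ax)) le_s]; rewrite big_cons.
have x_gt0 : 0 < x%:R :> R by rewrite ltr0n (ltn_trans a_gt0).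
have x_ge1 : 0 <= 1 - x%:R^-1 :> R.
  by rewrite subr_ge0 invf_le1 // ler1n (ltn_trans a_gt0).
apply: le_trans (ler_wpM2l x_ge1 le_s).
rewrite !natrD -natr1.
have s_ge0 : 0 <= (size s)%:R :> R by [].
have a0 : 0 < a%:R :> R by rewrite ltr0n.
have ax : a%:R + 1 <= x%:R :> R by rewrite natr1 ler_nat.
have -> : (1 - x%:R^-1) * (x%:R / (x%:R + (size s)%:R)) =
    (x%:R - 1) / (x%:R + (size s)%:R) :> R.
  by field; rewrite !lt0r_neq0 // ltr_pwDl.
rewrite ler_pdivrMr ?ltr_pwDl ?addr_ge0 // mulrAC ler_pdivlMr ?ltr_pwDl //.
have : 0 <= (x%:R - 1 - a%:R) * ((size s)%:R + 1) :> R.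
  by apply: mulr_ge0; lra.
lra.
Qed.

(* Midpoint comparison of [k^-4] with the integral of [x^-4] over              *)
(* [k - 1/2, k + 1/2], telescoped.                                             *)
Lemma sum_path_exp4_le a (s : seq nat) : path ltn a s ->
  \sum_(p <- s) p%:R ^- 4 <= 8 / (3 * (2 * a%:R + 1) ^+ 3) :> R.
Proof.
elim: s a => [|x s IHs] a /=.
  by rewrite big_nil divr_ge0 // mulr_ge0 // exprn_ge0 // addr_ge0 // mulr_ge0.
move=> /andP[lt_ax /IHs le_s]; rewrite big_cons.
apply: le_trans (lerD (lexx _) le_s) _.
have a0 : 0 <= a%:R :> R by [].
have ax : a%:R + 1 <= x%:R :> R by rewrite natr1 ler_nat.
move: (a%:R) (x%:R) a0 ax => {lt_ax le_s}{}a {}x a0 ax.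
have y1 : 0 < 2 * x - 1 by lra.
have z1 : 0 < 2 * x + 1 by lra.
have x0 : 0 < x by lra.
have w1 : 0 < 2 * a + 1 by lra.
apply: (@le_trans _ _ (8 / (3 * (2 * x - 1) ^+ 3))); last first.
  rewrite ler_pM2l // lef_pV2 ?posrE ?mulr_gt0 ?exprn_gt0 //.
  by rewrite ler_pM2l // lerXn2r ?nnegrE; lra.
rewrite -subr_ge0.
have -> : 8 / (3 * (2 * x - 1) ^+ 3) - (x ^- 4 + 8 / (3 * (2 * x + 1) ^+ 3)) =
    (160 * x ^+ 4 - 36 * x ^+ 2 + 3) /
    (3 * x ^+ 4 * (2 * x - 1) ^+ 3 * (2 * x + 1) ^+ 3).
  by field; rewrite !lt0r_neq0.
rewrite divr_ge0 ?mulr_ge0 ?exprn_ge0 ?ltW //.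
have x2 : 1 <= x ^+ 2 by apply: exprn_ege1; lra.
by rewrite (exprM x 2 2); nra.
Qed.

Lemma path_primes m : path ltn 1 (primes m).
Proof.
rewrite path_sortedE; last exact: ltn_trans.
rewrite sorted_primes andbT; apply/allP => p.
by rewrite mem_primes => /andP[/prime_gt1].
Qed.

Lemma totient_size_primes m : (0 < m)%N ->
  m%:R <= (size (primes m)).+1%:R * (totient m)%:R :> R.
Proof.
move=> m_gt0; rewrite (totient_prodr m_gt0 (dvdnn m)).
have := prod_path_ge (ltn0Sn 0) (path_primes m).
rewrite ler_pdivrMr ?ltr0n ?add1n // => ge1.
rewrite mulrCA ler_peMr ?ler0n // mulrC; apply: le_trans ge1 _.
rewrite ler_wpM2r // le_eqVlt; apply/orP; left; apply/eqP.
rewrite big_seq [RHS]big_seq_cond; apply: eq_bigl => p.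
by rewrite mem_primes; case: (p %| m)%N; rewrite ?andbT ?andbF.
Qed.

(** With [w] primes, [m <= (w + 1) * totient m], so [2 * (w + 1) * (8 / 81) <= 2 ^ (X - 3)]
    suffices; this is the last hypothesis. *)
Lemma sum_deficit_small m X : (0 < m)%N -> (3 <= X)%N ->
  (forall p, p \in primes m -> (p ^ X %| m)%N) ->
  ((size (primes m)).+1 * 128 <= 81 * 2 ^ X)%N ->
  2 * \sum_(u <- divisors m) ((totient (m %/ u))%:R - (totient m)%:R / u%:R)
    <= (totient m)%:R :> R.
Proof.
move=> m_gt0 X_ge3 pX_m small.
(* [p >= 2] is used on [X - 3] of the [X + 1] factors; [8 / 81] bounds the remaining sum of [p ^- 4]
   over integers above [a = 1]. *)
have S_le : \sum_(p <- primes m) p%:R ^- X.+1 <= 2 ^- (X - 3) * (8 / 81) :> R.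
  apply: (@le_trans _ _ (2 ^- (X - 3) * \sum_(p <- primes m) p%:R ^- 4)).
    rewrite mulr_sumr big_seq [leRHS]big_seq; apply: ler_sum => p.
    rewrite mem_primes => /andP[/prime_gt1 p_gt1 _].
    have p2 : 2 <= p%:R :> R by rewrite (ler_nat _ 2).
    have p0 : 0 < p%:R :> R by rewrite ltr0n ltnW.
    have -> : X.+1 = (X - 3 + 4)%N by lia.
    rewrite exprD invfM ler_pM2r ?invr_gt0 ?exprn_gt0 //.
    rewrite lef_pV2 ?posrE ?exprn_gt0 // lerXn2r ?nnegrE //.
  rewrite ler_pM2l ?invr_gt0 ?exprn_gt0 //.
  apply: le_trans (sum_path_exp4_le (path_primes m)) _.
  by rewrite le_eqVlt; apply/orP; left; apply/eqP; field.
have D_le := sum_deficit_le m_gt0 pX_m.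
have T_ge := totient_size_primes m_gt0.
have {}small : (size (primes m)).+1%:R * 128 <= 81 * (8 * 2 ^+ (X - 3)) :> R.
  have -> : 8 * 2 ^+ (X - 3) = (2 ^ X)%:R :> R.
    rewrite -[in RHS](subnK X_ge3) expnD natrM natrX mulrC; congr (_ * _).
  by rewrite -!natrM ler_nat.
have q_gt0 : 0 < 2 ^+ (X - 3) :> R by rewrite exprn_gt0.
set q := 2 ^+ (X - 3) in S_le small q_gt0.
have T0 : 0 <= (totient m)%:R :> R by [].
have m0 : 0 <= m%:R :> R by [].
apply: (@le_trans _ _ (2 * (m%:R * (q^-1 * (8 / 81))))).
  by rewrite ler_pM2l //; apply: le_trans D_le _; rewrite ler_wpM2l.
rewrite [X in _ <= X](_ : _ = 2 * ((q * 81 / 16 * (totient m)%:R) * (q^-1 * (8/81)))).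
  rewrite ler_pM2l // ler_wpM2r //.
    by apply: mulr_ge0; rewrite ?invr_ge0 ltW // divr_gt0.
  apply: le_trans T_ge _; rewrite ler_wpM2r //; lra.
by field; rewrite lt0r_neq0.
Qed.

End RealEstimates.

(** * Comparison with the linear program *)

(* Twice an upper bound for the density of a product-free set in the class of  *)
(* gcd [u].  With weight 2 at every [u], [small_excess] would fail for n = 6   *)
(* and n = 15.                                                                 *)
Definition unitary_weight (m u : nat) : nat := if coprime u (m %/ u) then 1 else 2.

(** The bound [alpha 1 <= 1/2] leaves [totient m / 2] for the excess; doubling makes the weights
    integers. *)
Definition small_excess (R : realFieldType) (m : nat) : Prop :=
  \sum_(u <- divisors m) (unitary_weight m u)%:R *
    ((totient (m %/ u))%:R - (totient m)%:R / u%:R) <= (totient m)%:R :> R.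

Lemma LP_objective_le (R : realType) m (alpha : nat -> R) : (0 < m)%N ->
  LP_feasible m alpha -> LP_objective m alpha <= LP_opt R m.
Proof.
move=> m_gt0 feas; apply: ub_le_sup; last by exists alpha.
exists (\sum_(u <- divisors m | (1 < u)%N) u%:R^-1) => _ [beta [b01 _] <-].
rewrite /LP_objective big_seq_cond [leRHS]big_seq_cond; apply: ler_sum => u.
rewrite -dvdn_divisors // => /andP[u_m u_gt1].
have /andP[_ b1] := b01 u u_gt1 u_m.
by rewrite -[leRHS]mul1r ler_wpM2r // invr_ge0.
Qed.

(** * The densities as a feasible point *)

Section Bound.
Variables (R : realType) (M : nat).
Let m := M.+1.
Variable S : {set 'I_m}.
Hypothesis S_free : forall a b, a \in S -> b \in S -> inZp (a * b) \notin S.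

Definition shift_density (u : nat) : R :=
  #|unit_shift S u|%:R / (totient m)%:R.

Let phi_gt0 : 0 < (totient m)%:R :> R.
Proof. by rewrite ltr0n totient_gt0. Qed.

Lemma shift_density_itv u : 0 <= shift_density u <= 1.
Proof.
rewrite divr_ge0 //= ler_pdivrMr // mul1r ler_nat -card_zunits.
by apply/subset_leq_card/fintype.subsetP => x; rewrite inE => /andP[].
Qed.

(** If [alpha u = 0], the other two densities sum to at most 2. Otherwise
    [alpha v + alpha (u * v) <= 1]. *)
Lemma shift_density_feasible : LP_feasible m shift_density.
Proof.
split=> [u _ _|u v _ _ _]; first exact: shift_density_itv.
have /andP[u0 u1] := shift_density_itv u.
have /andP[v0 v1] := shift_density_itv v.
have /andP[uv0 uv1] := shift_density_itv (u * v).
have [u_gt0|] := ltnP 0 #|unit_shift S u|; last first.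
  rewrite leqn0 => /eqP u_eq0.
  have -> : shift_density u = 0 by rewrite /shift_density u_eq0 mul0r.
  lra.
suff : shift_density v + shift_density (u * v) <= 1 by lra.
rewrite -mulrDl ler_pdivrMr // mul1r -natrD ler_nat.
exact: unit_shift_product.
Qed.

Lemma card_class_density u : (u %| m)%N ->
  #|S :&: gcd_class M u|%:R = shift_density u * (totient (m %/ u))%:R :> R.
Proof.
move=> u_m; rewrite /shift_density mulrAC -natrM -card_unit_shift // natrM mulfK //.
exact: lt0r_neq0.
Qed.

Lemma shift_density_weight u : (u %| m)%N ->
  2 * shift_density u <= (unitary_weight m u)%:R.
Proof.
move=> u_m; rewrite /unitary_weight; case: ifP => [co_u|_]; last first.
  by have := shift_density_itv u; lra.
have phi_u : 0 < (totient (m %/ u))%:R :> R.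
  rewrite ltr0n totient_gt0 divn_gt0; last exact: dvdn_gt0 u_m.
  exact: dvdn_leq.
rewrite -(ler_pM2r phi_u) mul1r -mulrA -card_class_density // -natrM ler_nat.
exact: card_unitary_class.
Qed.

(** [#|S|] equals [totient m * (alpha 1 + objective)] plus the excess; the [alpha 1] term and the
    excess are each at most [totient m / 2]. *)
Lemma card_product_free_le : small_excess R m ->
  #|S|%:R <= (totient m)%:R * (1 + LP_opt R m) :> R.
Proof.
rewrite /small_excess => excess.
have obj_le := LP_objective_le (ltn0Sn M) shift_density_feasible.
have cardE : #|S|%:R = \sum_(u <- divisors m)
    shift_density u * (totient (m %/ u))%:R :> R.
  rewrite card_gcd_classes natr_sum; apply: eq_big_seq => u.
  by rewrite -dvdn_divisors // => /card_class_density.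
have objE : \sum_(u <- divisors m) shift_density u / u%:R =
    shift_density 1 + LP_objective m shift_density.
  rewrite (bigD1_seq 1%N) ?divisors_uniq -?dvdn_divisors //= divr1.
  congr (_ + _); rewrite big_seq_cond [RHS]big_seq_cond; apply: eq_bigl => u.
  rewrite -dvdn_divisors //; case: (boolP (u %| m)%N) => //= u_m.
  by have := dvdn_gt0 (ltn0Sn M) u_m; case: u u_m => [|[]].
have diff_le : 2 * (\sum_(u <- divisors m)
    shift_density u * ((totient (m %/ u))%:R - (totient m)%:R / u%:R)) <=
    (totient m)%:R.
  apply: le_trans excess; rewrite mulr_sumr big_seq [leRHS]big_seq.
  apply: ler_sum => u; rewrite -dvdn_divisors // => u_m.
  rewrite mulrA ler_wpM2r ?shift_density_weight //.
  by have /andP[] := totient_deficit R (ltn0Sn M) u_m.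
have one_le : 2 * shift_density 1 <= 1.
  by have := shift_density_weight (dvd1n m); rewrite /unitary_weight coprime1n.
have diffE : \sum_(u <- divisors m)
    shift_density u * ((totient (m %/ u))%:R - (totient m)%:R / u%:R) =
    #|S|%:R - (totient m)%:R * (shift_density 1 + LP_objective m shift_density).
  rewrite cardE -objE mulr_sumr -sumrB; apply: eq_bigr => u _.
  by rewrite mulrBr; congr (_ - _); rewrite mulrCA.
rewrite diffE in diff_le.
have := ler_wpM2l (ltW phi_gt0) obj_le.
have := ler_wpM2l (ltW phi_gt0) one_le.
lra.
Qed.

End Bound.

Lemma max_density_le (R : realType) m : (0 < m)%N -> small_excess R m ->
  max_density R m <= (totient m)%:R / m%:R * (1 + LP_opt R m).
Proof.
case: m => // M _ excess; rewrite /max_density mulrAC.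
rewrite ler_pM2r ?invr_gt0 ?ltr0n //.
elim/big_ind: _ => [|a b Pa Pb|S /asboolP S_free].
(* The default value 0 of the maximum is the size of the empty set. *)
- have := @card_product_free_le R M (finset.set0 : {set 'I_M.+1}).
  by rewrite cards0; apply=> // a b; rewrite inE.
- by rewrite /maxn; case: ifP.
apply: card_product_free_le => // a b aS bS; apply/negP => abS; apply: S_free.
by exists a, b, (inZp (a * b)); split; rewrite //= modn_mod.
Qed.

(* [small_excess m] with denominators cleared; the products are too large to   *)
(* be evaluated in unary.                                                      *)
Definition small_excess_check (m : nat) : bool :=
  let A := sumn [seq unitary_weight m u * totient (m %/ u) | u <- divisors m]%N in
  let B := sumn [seq unitary_weight m u * (m %/ u) | u <- divisors m]%N in
  BinNat.N.leb (BinNat.N.mul (BinNat.N.of_nat A) (BinNat.N.of_nat m))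
    (BinNat.N.mul (BinNat.N.of_nat (totient m)) (BinNat.N.of_nat (m + B))).

Lemma small_excess_checkP (R : realFieldType) m : (0 < m)%N ->
  small_excess_check m -> small_excess R m.
Proof.
move=> m_gt0; rewrite /small_excess_check !sumnE !big_map.
set A := (\sum_(_ <- _) _)%N; set B := (\sum_(_ <- _) _)%N.
move=> AB; have {AB} : (A * m <= totient m * (m + B))%N by lia.
rewrite -(ler_nat R) !natrM natrD => AB.
have m0 : 0 < m%:R :> R by rewrite ltr0n.
rewrite /small_excess -(ler_pM2r m0).
have -> : \sum_(u <- divisors m) (unitary_weight m u)%:R *
    ((totient (m %/ u))%:R - (totient m)%:R / u%:R) =
    A%:R - (totient m)%:R * (B%:R / m%:R) :> R.
  rewrite !natr_sum mulr_suml mulr_sumr -sumrB; apply: eq_big_seq => u.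
  rewrite -dvdn_divisors // => u_m.
  have u0 : u%:R != 0 :> R by rewrite pnatr_eq0 -lt0n (dvdn_gt0 m_gt0).
  rewrite !natrM [(m %/ u)%:R]natf_div //; field.
  by rewrite u0 lt0r_neq0.
rewrite mulrBl mulrA divfK ?lt0r_neq0 //; lra.
Qed.

Lemma small_excess_powerful (R : realFieldType) m X : (0 < m)%N -> (3 <= X)%N ->
  (forall p, p \in primes m -> (p ^ X %| m)%N) ->
  ((size (primes m)).+1 * 128 <= 81 * 2 ^ X)%N -> small_excess R m.
Proof.
move=> m_gt0 X_ge3 pX_m small.
apply: le_trans (sum_deficit_small R m_gt0 X_ge3 pX_m small).
rewrite mulr_sumr big_seq [leRHS]big_seq; apply: ler_sum => u.
rewrite -dvdn_divisors // => u_m.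
have /andP[d0 _] := totient_deficit R m_gt0 u_m.
by rewrite ler_wpM2r // /unitary_weight; case: ifP; rewrite ?ler1n.
Qed.

(** Covers [X = 1]: the prime product is empty, so [N = n], and [n < 3 ^ 2]. *)
Lemma small_excess_le8 n : (0 < n < 9)%N -> small_excess_check n.
Proof.
move=> n_lt; have : all small_excess_check (iota 1 8) by vm_compute.
by move/allP; apply; rewrite mem_iota.
Qed.

(** Covers [X = 2]: the prime product is 2, and [n < 3 ^ 3]. *)
Lemma small_excess_square n : (0 < n < 27)%N -> small_excess_check ((n * 2) ^ 2).
Proof.
move=> n_lt.
have : all (fun n => small_excess_check ((n * 2) ^ 2)) (iota 1 26) by vm_compute.
by move/allP; apply; rewrite mem_iota.
Qed.

(** * The modulus N *)

Lemma expR1_le3 (R : realType) : expR 1 <= 3 :> R.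
Proof.
(* 6 is the least [k] with [(1 - 1/k) ^ k >= 1/3]. *)
have e6 : expR (- 1) = expR (- 6^-1) ^+ 6 :> R.
  by rewrite -expRM_natl; congr expR; field.
have e0 : 0 < expR 1 :> R := expR_gt0 1.
rewrite -[leRHS]invrK -[leLHS]invrK lef_pV2 ?posrE ?invr_gt0 // -expRN e6.
have lb : 5 / 6 <= expR (- 6^-1) :> R.
  by apply: le_trans (expR_ge1Dx _); lra.
apply: (@le_trans _ _ ((5 / 6) ^+ 6)); last first.
  by rewrite lerXn2r ?nnegrE ?expR_ge0 ?divr_ge0.
lra.
Qed.

(** Follows from [ln n < X + 1] and [e <= 3]; the excess estimate needs only this integer inequality
    about [X]. *)
Lemma ltn_exp3_X_of (R : realType) n : (0 < n)%N -> (n < 3 ^ (X_of R n).+1)%N.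
Proof.
move=> n_gt0; have n0 : 0 < n%:R :> R by rewrite ltr0n.
rewrite -(ltr_nat R) natrX -{1}[n%:R](@lnK R) ?posrE //.
apply: (@lt_le_trans _ _ (expR (X_of R n).+1%:R)).
  by rewrite ltr_expR truncnS_gt.
rewrite -[X in expR X]mulr1 expRM_natl lerXn2r ?nnegrE ?expR_ge0 //.
exact: expR1_le3.
Qed.

Lemma X_of_gt0 (R : realType) n : (2 < n)%N -> (0 < X_of R n)%N.
Proof.
move=> n_gt2; rewrite truncn_gt0 -[leLHS](@expRK R) ler_ln ?posrE ?expR_gt0 //.
  by apply: le_trans (expR1_le3 R) _; rewrite ler_nat.
by rewrite ltr0n; lia.
Qed.

Lemma exp_size_leq_prod q (s : seq nat) : {in s, forall p, (q <= p)%N} ->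
  (q ^ size s <= \prod_(p <- s) p)%N.
Proof.
elim: s => [|p s IHs] qs; first by rewrite big_nil.
rewrite big_cons expnS leq_mul ?qs ?mem_head //.
by apply: IHs => r rs; apply: qs; rewrite inE rs orbT.
Qed.

Lemma prod_primes_leq n (P : pred nat) : (0 < n)%N ->
  (\prod_(p <- primes n | P p) p <= n)%N.
Proof.
move=> n_gt0; rewrite [leqRHS](prod_prime_decomp n_gt0) prime_decompE big_map /=.
rewrite big_mkcond big_seq [leqRHS]big_seq; apply: leq_prod => p p_n.
have p_gt0 : (0 < p)%N by move: p_n; rewrite mem_primes => /andP[/prime_gt0].
case: ifP => _; last by rewrite expn_gt0 p_gt0.
by rewrite -[leqLHS]expn1 leq_pexp2l // logn_gt0.
Qed.

Section Modulus.
Variables n X : nat.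
Hypothesis n_gt0 : (0 < n)%N.
Let P := (\prod_(p < X.+1 | prime p) p)%N.

Let nP_gt0 : (0 < n * P)%N.
Proof. by rewrite muln_gt0 n_gt0 prodn_cond_gt0 // => p /prime_gt0. Qed.

Lemma mem_primes_modulus p : p \in primes (n * P) -> (X < p)%N -> p \in primes n.
Proof.
rewrite mem_primes => /and3P[p_pr _]; rewrite Euclid_dvdM // => p_nP lt_Xp.
rewrite mem_primes p_pr n_gt0 /=; case/orP: p_nP => //.
rewrite Euclid_dvd_prod // big_has_cond => /hasP[q _ /andP[q_pr]].
rewrite dvdn_prime2 // => /eqP p_q.
by have := ltn_ord q; rewrite -p_q ltnS leqNgt lt_Xp.
Qed.

(** Primes up to [X] lie in [2, ..., X]. The [r] others divide [n] and are at least [q], so their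
    product gives [q ^ r <= n]. *)
Lemma size_primes_modulus q : {in primes n, forall p, (X < p -> q <= p)%N} ->
  exists2 r, (size (primes (n * P)) <= X.-1 + r)%N & (q ^ r <= n)%N.
Proof.
move=> q_le; pose s := [seq p <- primes n | (X < p)%N].
exists (size s); last first.
  apply: leq_trans (prod_primes_leq (fun p => X < p)%N n_gt0).
  rewrite -big_filter; apply: exp_size_leq_prod => p.
  by rewrite mem_filter => /andP[lt_Xp p_n]; apply: q_le.
rewrite -(size_iota 2 X.-1) -size_cat; apply: uniq_leq_size; first exact: primes_uniq.
move=> p p_nP; rewrite mem_cat mem_iota mem_filter.
have p_gt1 : (1 < p)%N by move: p_nP; rewrite mem_primes => /andP[/prime_gt1].
have [lt_Xp|le_pX] := ltnP X p; last by rewrite p_gt1; apply/orP; left; lia.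
by rewrite (mem_primes_modulus p_nP lt_Xp) orbT.
Qed.

Lemma size_primes_modulus_small : (3 <= X)%N -> (n < 3 ^ X.+1)%N ->
  ((size (primes (n * P))).+1 * 128 <= 81 * 2 ^ X)%N.
Proof.
rewrite leq_eqVlt => /orP[/eqP X3|X_ge4] n_lt.
  (* The general count below would give [w + 1 <= 6], and [6 * 128 > 81 * 8]. Primes above 3 are at
     least 5 and [5 ^ 3 > 81], hence [w + 1 <= 5]. *)
  have [|r size_le qr_le] := @size_primes_modulus 5.
    move=> p; rewrite mem_primes -X3 => /andP[p_pr _].
    by case: p p_pr => [|[|[|[|[|]]]]].
  have r_lt3 : (r < 3)%N.
    rewrite -(ltn_exp2l _ _ (isT : 1 < 5)%N); apply: leq_ltn_trans qr_le _.
    by apply: ltn_trans n_lt _; rewrite -X3.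
  by move: size_le; rewrite -X3 /=; lia.
(* Here [(X + 1) ^ r <= n < 3 ^ (X + 1)] forces [r <= X], so [w + 1 <= 2 * X]. *)
have [|r size_le qr_le] := @size_primes_modulus X.+1; first by [].
have r_le : (r < X.+1)%N.
  rewrite -(@ltn_exp2l X.+1) //; last by lia.
  apply: leq_ltn_trans qr_le _; apply: leq_trans n_lt _.
  by rewrite leq_exp2r //; lia.
have X2 : (2 * X * 128 <= 81 * 2 ^ X)%N.
  move: X_ge4; clear; elim: X => // Y IHY; rewrite ltnS leq_eqVlt.
  by case/orP => [/eqP <- //|/[dup] Y_ge4 /IHY {}IHY]; rewrite expnS; lia.
by apply: leq_trans X2; rewrite leq_pmul2r //; lia.
Qed.

End Modulus.

Lemma small_excess_N_of (R : realType) n : (0 < n)%N -> small_excess R (N_of R n).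
Proof.
move=> n_gt0; have := ltn_exp3_X_of R n_gt0; rewrite /N_of.
move: (X_of R n) => X n_lt.
set P := (\prod_(p < X.+1 | prime p) p)%N.
have nP_gt0 : (0 < n * P)%N.
  by rewrite muln_gt0 n_gt0 prodn_cond_gt0 // => p /prime_gt0.
have [X_lt3|X_ge3] := ltnP X 3; last first.
  apply: (@small_excess_powerful _ _ X) => //.
  - by rewrite expn_gt0 nP_gt0.
  - move=> p; rewrite primesX; last by lia.
    by rewrite mem_primes => /and3P[_ _ p_nP]; apply: dvdn_exp2r.
  by rewrite primesX; [exact: size_primes_modulus_small | lia].
apply: small_excess_checkP; first by rewrite expn_gt0 nP_gt0.
rewrite {}/P in nP_gt0 *; case: X X_lt3 n_lt nP_gt0 => [|[|[|//]]] _ n_lt _.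
- by rewrite expn0.
- rewrite !big_mkcond !big_ord_recr big_ord0 /= !muln1 expn1.
  by apply: small_excess_le8; rewrite n_gt0.
- rewrite !big_mkcond !big_ord_recr big_ord0 /= !mul1n.
  by apply: small_excess_square; rewrite n_gt0.
Qed.

(** For [n = 2] one has [X = 0] and [N = 1], so divisibility fails there and is asserted for the
    other [n]; the density bound includes [n = 2]. *)
Theorem theorem4p1 (R : realType) (n : nat) (n_gt0 : (0 < n)%N) :
  (n <> 2%N -> (n %| N_of R n)%N) /\
  max_density R (N_of R n) <=
    (totient (N_of R n))%:R / (N_of R n)%:R * (1 + LP_opt R (N_of R n)).
Proof.
split=> [n_neq2|].
  case: n n_gt0 n_neq2 => [//|[//|[//|n _ _]]].
  rewrite /N_of; have := X_of_gt0 R (isT : 2 < n.+3)%N.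
  by case: (X_of R n.+3) => // X _; rewrite expnS -mulnA dvdn_mulr.
apply: max_density_le (small_excess_N_of R n_gt0).
rewrite /N_of expn_gt0 muln_gt0 n_gt0 prodn_cond_gt0 // => p; exact: prime_gt0.
Qed.
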